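(* Let $(A,\vec b,\vec c)$ be an $s$-stage Runge-Kutta scheme satisfying the assumptions listed in the context. Fix $\omega\in\mathbb{R}$, $\omega\neq 0$, and for $\Delta t>0$ put $z=e^{\mathrm{i}\omega\Delta t}$ and, whenever $z\neq 1$, $$M=M(\Delta t)=\Delta t\,A+\frac{\Delta t}{z-1}\,\vec e\,\vec b^{\,T}\in\mathbb{C}^{s\times s}.$$ Then for all sufficiently small $\Delta t>0$ (in particular with $z\ne 1$) the eigenvalues of $M$, counted with algebraic multiplicity, can be labeled $\lambda_1(\Delta t),\dots,\lambda_s(\Delta t)$ so that, as $\Delta t\to 0$: (1) $\lambda_1=\frac{1}{\mathrm{i}\omega}+O(\Delta t)$, so $\lambda_1=O(1)$ and is bounded away from $0$; the corresponding right and left eigenvectors are, to leading order (i.e. in the limit $\Delta t\to0$, after suitable scaling), $\vec e$ and $\vec b$, respectively. (2) The other $s-1$ eigenvalues (including multiplicity) are nonzero and of magnitude at most $O(\Delta t)$. They have the form $\lambda=\Delta t\,\mu_0+o(\Delta t)$, where the $\mu_0$ are the eigenvalues (with multiplicity) of the linear map $B:\vec b^\perp\to\vec b^\perp$ given by restricting $QA$ to $\vec b^{\perp}$, with $Q=I-\vec e\,\vec b^{\,T}$ the projection onto $\vec b^\perp$ along $\vec e$. (3) $M$ has no zero eigenvalue.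
   Context: A Runge-Kutta (RK) scheme with $s$ stages is given by a matrix $A\in\mathbb{R}^{s\times s}$ and a vector $\vec b\in\mathbb{R}^s$; $\vec e=(1,\dots,1)^T\in\mathbb{R}^s$ and $\vec c=A\vec e$. The scheme is consistent (order at least one), i.e. $\vec b^{\,T}\vec e=1$. Notation: $\vec b^\perp=\{\vec v:\vec b^{\,T}\vec v=0\}$. Standing assumptions on the scheme: (i) the eigenvalues of $A$ have non-negative real parts; (ii) there are constants $\delta_d,c_d>0$ such that for every complex $w$ with $|w|<\delta_d$ the matrix $\vec e\,\vec b^{\,T}+wA$ is diagonalizable, and eigenvector matrices $T(w)$ can be selected with $\|T(w)\|\,\|T(w)^{-1}\|<c_d$; (iii) $A$ is invertible and $\vec b^{\,T}A^{-1}\vec e\neq 0$. *)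

(* Defs.v *)
From HB Require Import structures.
From mathcomp Require Import all_boot all_order all_algebra.
From mathcomp Require Import all_classical all_reals all_analysis.
From mathcomp Require Import complex.

Set Implicit Arguments.
Unset Strict Implicit.
Unset Printing Implicit Defensive.

Import Order.TTheory GRing.Theory Num.Theory.
Import numFieldNormedType.Exports.
Import ComplexField.Normc.

Local Open Scope ring_scope.
Local Open Scope classical_set_scope.
Local Open Scope complex_scope.

Notation mxC A := (map_mx (real_complex _) A).

(* [f =O_(0^'+) g] does not parse, [f =O_right0 g] does. *)
Notation right0 := (at_right 0).

Definition ones (R : realType) (s : nat) : 'cV[R]_s := const_mx 1.

Definition cexpi (R : realType) (theta : R) : R[i] := cos theta +i* sin theta.

Definition consistent (R : realType) (s : nat) (b : 'cV[R]_s) : Prop :=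
  b^T *m ones R s = 1%:M.

Definition spectrum_nonneg_Re (R : realType) (s : nat) (A : 'M[R]_s) : Prop :=
  forall l : R[i], eigenvalue (mxC A) l -> 0 <= complex.Re l.

(* The columns of [T] are eigenvectors of [e b^T + w A].  [`|T|] is the maximum
   of the moduli of the entries of [T]; another norm only changes [cd]. *)
Definition uniformly_diagonalizable (R : realType) (s : nat)
    (A : 'M[R]_s) (b : 'cV[R]_s) : Prop :=
  exists deltad : R, exists cd : R, [/\ 0 < deltad, 0 < cd &
    forall w : R[i], normc w < deltad ->
      exists T : 'M[R[i]]_s, [/\ T \in unitmx,
        is_diag_mx (invmx T *m (mxC (ones R s *m b^T) + w *: mxC A) *m T) &
        `|T| * `|invmx T| < cd%:C]].

Definition stepM (R : realType) (s : nat) (A : 'M[R]_s) (b : 'cV[R]_s)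
    (omega dt : R) : 'M[R[i]]_s :=
  dt%:C *: mxC A
  + (dt%:C / (cexpi (omega * dt) - 1)) *: mxC (ones R s *m b^T).

Definition projQ (R : realType) (s : nat) (b : 'cV[R]_s) : 'M[R]_s :=
  1%:M - ones R s *m b^T.

(* MathComp matrices act on row vectors: the row space of [kermx b] is
   [{u | u b = 0}], i.e. the transpose of b^perp, and [v |-> Q A v] on columns
   is [u |-> u (Q A)^T] on rows.  [restrictmx] is the matrix, in a basis of
   b^perp, of the restriction, see [stable_bperp]. *)
Definition restrB (R : realType) (s : nat) (A : 'M[R]_s) (b : 'cV[R]_s) :
    'M[R]_(\rank (kermx b)) :=
  restrictmx (kermx b) (projQ b *m A)^T.

Lemma stable_bperp (R : realType) (s : nat) (A : 'M[R]_s) (b : 'cV[R]_s) :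
  consistent b -> stablemx (kermx b) (projQ b *m A)^T.
Proof.
move=> hb; apply/sub_kermxP; rewrite -mulmxA; apply/eqP; rewrite -trmx_eq0.
rewrite trmx_mul trmx_mul trmxK mulmxA /projQ mulmxBr mulmx1 mulmxA hb.
by rewrite mul1mx subrr !mul0mx.
Qed.

Definition tends_upto_scaling (R : realType) (m n : nat)
    (v : R -> 'M[R[i]]_(m, n)) (v0 : 'M[R]_(m, n)) : Prop :=
  exists k : R -> R[i], (\forall dt \near right0, k dt != 0) /\
    forall i j, normc (k dt * v dt i j - (v0 i j)%:C) @[dt --> right0] --> (0 : R).

(* Main.v *)
(** With [w = z - 1] and [N = e b^T + w A] one has [M = (dt / w) N], where
[dt / w] tends to [1 / (i omega)].  As [w] tends to 0, [N] tends to the rank one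
matrix [e b^T], whose eigenvalue 1 is simple; this gives [lambda_1] and, by
Cramer's rule applied to [(nu - w A) v = (b^T v) e], its eigenvectors.  For the
other eigenvalues, write [M = dt (A + w^-1 e b^T)].  In a basis adapted to
[e] and [b^perp] the rank one update changes a single diagonal entry, so that
[char_poly (A + w^-1 e b^T) = char_poly A - w^-1 char_poly B].  After
multiplication by [w] the right-hand side tends to [- char_poly B]; the degree
drop accounts for [lambda_1 / dt], which escapes to infinity, and the other roots
converge to those of [char_poly B] by continuity of roots. *)

Require Import Defs.
From HB Require Import structures.
From mathcomp Require Import all_boot all_order all_algebra.
From mathcomp Require Import all_classical all_reals all_analysis.
From mathcomp Require Import complex.

Set Implicit Arguments.
Unset Strict Implicit.
Unset Printing Implicit Defensive.

Import Order.TTheory GRing.Theory Num.Theory.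
Import numFieldNormedType.Exports.
Import ComplexField.Normc.

Local Open Scope ring_scope.
Local Open Scope classical_set_scope.
Local Open Scope complex_scope.

(** * Algebra of characteristic polynomials and their roots *)

Lemma char_poly_trmx (R : comNzRingType) (n : nat) (M : 'M[R]_n) :
  char_poly M^T = char_poly M.
Proof.
rewrite /char_poly -[in RHS]det_tr /char_poly_mx; congr (\det _).
by rewrite linearB /= tr_scalar_mx map_trmx.
Qed.

(** [S] also intertwines the two characteristic matrices, and its determinant, a nonzero constant,
    cancels. *)
Lemma char_poly_intertwine (F : fieldType) (n : nat) (S M N : 'M[F]_n) :
  S \in unitmx -> S *m M = N *m S -> char_poly M = char_poly N.
Proof.
move=> Su SM; have : map_mx polyC S *m char_poly_mx M
    = char_poly_mx N *m map_mx polyC S.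
  by rewrite /char_poly_mx mulmxBr mulmxBl -!map_mxM SM scalar_mxC.
move/(congr1 determinant); rewrite !det_mulmx det_map_mx mulrC.
apply: mulIf; rewrite polyC_eq0.
by move: Su; rewrite unitmxE unitfE.
Qed.

(* Rows act as transposed columns: the rows of [V] are a basis of
   [b^perp], and [B] is the matrix of [Q A] restricted to it.  In the basis
   formed by [e] and [V], the update only changes the upper left entry. *)
Lemma char_poly_rank1_update (F : fieldType) (n r : nat) (A : 'M[F]_n)
    (e b : 'cV[F]_n) (V : 'M[F]_(r, n)) (B : 'M[F]_r) (u : F) :
  r.+1 = n ->
  b^T *m e = 1%:M -> row_free V -> V *m b = 0 ->
  V *m ((1%:M - e *m b^T) *m A)^T = B *m V ->
  char_poly (A + u *: (e *m b^T)) = char_poly A - u *: char_poly B.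
Proof.
move=> rn; case: n / rn in A e b V * => be fV Vb VB.
have eb : e^T *m b = 1%:M by rewrite -[b]trmxK -trmx_mul be trmx1.
pose S : 'M[F]_(1 + r) := @col_mx F 1 r _ e^T V.
have Su : S \in unitmx.
  rewrite -row_free_unit; apply: inj_row_free => v.
  rewrite -[v](@hsubmxK _ 1 1 r) mul_row_col => vS0.
  have v1 : lsubmx (v : 'M[F]_(1, 1 + r)) = 0.
    have /(congr1 (mulmx^~ b)) := vS0.
    by rewrite mulmxDl -!mulmxA eb Vb mulmx0 addr0 mulmx1 mul0mx.
  move: vS0; rewrite v1 mul0mx add0r => /eqP.
  by rewrite mulmx_free_eq0 // => /eqP ->; rewrite row_mx0.
pose h := V *m A^T *m b.
pose G : 'M[F]_(1 + r) := S *m A^T *m invmx S.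
pose E : 'M[F]_(1 + r) := block_mx 1%:M 0 0 0.
have SE : S *m (e *m b^T)^T = E *m S.
  rewrite trmx_mul trmxK mulmxA mul_col_mx eb Vb mul_col_mx mul1mx mul0mx.
  by rewrite /S /E mul_block_col !mul0mx !addr0 mul1mx.
(* Expanding the projection gives [V A^T = h e^T + B V]: in the basis [S], the rows of [V A^T] have
   coordinates [h] along [e^T] and [B] along [V]. *)
have GB : dsubmx G = row_mx h B.
  have VA : V *m A^T = row_mx h B *m S.
    rewrite mul_row_col -VB mulmxBl mul1mx linearB /= -mulmxA trmx_mul trmx_mul.
    by rewrite trmxK mulmxBr !mulmxA addrCA subrr addr0.
  rewrite -[G]/(col_mx e^T V *m A^T *m invmx S) mul_col_mx mul_col_mx col_mxKd.
  by rewrite VA -mulmxA mulmxV // mulmx1.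
have GA : char_poly A = char_poly G.
  rewrite -char_poly_trmx; apply: (char_poly_intertwine Su).
  by rewrite /G mulmxKV.
have GU : char_poly (A + u *: (e *m b^T)) = char_poly (G + u *: E).
  rewrite -char_poly_trmx; apply: (char_poly_intertwine Su).
  rewrite linearD /= mulmxDr mulmxDl linearZ /= -scalemxAr SE -scalemxAl.
  by rewrite /G mulmxKV.
move: G h GB GA GU => G h GB GA GU.
(* [C] is the characteristic matrix of [G] with its first row replaced by the first unit vector, the
   direction in which [u E] moves that row. *)
pose C : 'M[{poly F}]_(1 + r) :=
  block_mx 1%:M 0 (- map_mx polyC h) (char_poly_mx B).
have dC : \det C = char_poly B.
  by rewrite (@det_lblock _ 1 r) det1 mul1r.
have dG i j : G (rshift 1 i) j = row_mx h B i j by rewrite -GB [RHS]mxE.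
have dE i j : E (rshift 1 i) j = 0.
  by rewrite -[E]/(col_mx (row_mx _ _) (row_mx 0 0)) col_mxEd row_mx0 mxE.
have EC j : (C (lshift r ord0) j = (E (lshift r ord0) j)%:P).
  rewrite -[E]/(col_mx (row_mx _ _) (row_mx 0 0)) -[C]/(col_mx (row_mx _ _) _).
  rewrite !col_mxEu.
  by case: (split_ordP j) => k ->; rewrite ?row_mxEl ?row_mxEr ?mxE ?ord1.
have dCe i j : C (rshift 1 i) j = char_poly_mx G (rshift 1 i) j.
  rewrite -[C]/(col_mx _ (row_mx _ _)) col_mxEd 4![in RHS]mxE dG.
  case: (split_ordP j) => k ->; rewrite ?row_mxEl ?row_mxEr !mxE.
    by rewrite eq_rlshift mulr0n sub0r.
  by rewrite eq_rshift.
have lift1 i : lift (lshift r ord0) i = rshift 1 i.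
  by apply: val_inj.
have {GU} -> := GU; rewrite GA -{}dC /char_poly -mul_polyC -mulNr.
move: C E dE EC dCe {SE} => C E dE EC dCe.
(* The determinant is linear in the first row, the only one in which the three matrices differ. *)
rewrite (@determinant_multilinear _ _ _ (char_poly_mx G) C
  (lshift r ord0) 1 (- u%:P)) ?mul1r //.
- by apply/rowP=> j; rewrite !mxE EC mul1r polyCD polyCM opprD addrA mulNr.
- by apply/matrixP=> i j; rewrite !mxE lift1 dE mulr0 addr0.
- by apply/matrixP=> i j; rewrite mxE [RHS]mxE lift1 dCe !mxE dE mulr0 addr0.
Qed.

(** For [c != 0], [X - c A = c (X / c - A)], so the polynomial is [c^n] times that of [A] at
    [X / c]. For [c = 0] both sides are [X^n]. *)
Lemma char_poly_scale (F : fieldType) (n : nat) (A : 'M[F]_n) (c : F)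
    (rho : 'I_n -> F) :
  char_poly A = \prod_(i < n) ('X - (rho i)%:P) ->
  char_poly (c *: A) = \prod_(i < n) ('X - (c * rho i)%:P).
Proof.
have [-> _|c0 chA] := eqVneq c 0.
  rewrite scale0r char_poly_trig; last by apply/is_trig_mxP => i j _; rewrite mxE.
  by apply: eq_bigr => i _; rewrite mxE mul0r.
have cX : c%:P * (c^-1 *: 'X) = 'X :> {poly F}.
  by rewrite mul_polyC scalerA mulfV // scale1r.
have -> : char_poly (c *: A) = c%:P ^+ n * (char_poly A \Po (c^-1 *: 'X)).
  rewrite -det_map_mx -detZ; congr (\det _); apply/matrixP => i j.
  rewrite !mxE rmorphB /= rmorphMn /= comp_polyX comp_polyC mulrBr mulrnAr cX.
  by rewrite polyCM.
rewrite chA rmorph_prod /= -[in c%:P ^+ n](card_ord n) -prodr_const -big_split.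
apply: eq_bigr => i _ /=.
by rewrite rmorphB /= comp_polyX comp_polyC mulrBr cX polyCM.
Qed.

Lemma prod_XsubC_seq (K : numClosedFieldType) (n : nat) (p : {poly K}) :
  p \is monic -> size p = n.+1 ->
  exists rho : 'I_n -> K, p = \prod_(i < n) ('X - (rho i)%:P).
Proof.
move=> /monicP lp sp; have [rs] := closed_field_poly_normal p.
rewrite lp scale1r => prs; exists (fun i => rs`_i).
have srs : size rs = n by move: sp; rewrite prs size_prod_XsubC => -[].
by rewrite prs (big_nth 0) srs big_mkord.
Qed.

(** The modulus of [p] at [x] is the product of the distances from [x] to the [n.+1] roots, each at
    least the distance to the nearest one. *)
Lemma nearest_root (K : numClosedFieldType) (n : nat) (p : {poly K}) (x : K) :
  p \is monic -> size p = n.+2 ->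
  exists2 r, root p r & `|x - r| ^+ n.+1 <= `|p.[x]|.
Proof.
move=> /monicP lp sp; have [rs] := closed_field_poly_normal p.
rewrite lp scale1r => prs.
have srs : size rs = n.+1 by move: sp; rewrite prs size_prod_XsubC => -[].
have [r rrs r_min] : exists2 r, r \in rs & {in rs, forall y, `|x - r| <= `|x - y|}.
  elim: rs {prs} n srs {sp} => [//|z [|z' rs] IH] n _.
    by exists z => [|y]; rewrite mem_seq1 // => /eqP ->.
  have [//|r rrs r_min] := IH (size rs).
  (* The order of [K] is only partial, but norms are real and hence comparable. *)
  have [zr|rz] := real_leP (normr_real (x - z)) (normr_real (x - r)).
    exists z; first exact: mem_head.
    by move=> y /predU1P[->//|/r_min]; apply: le_trans.
  exists r; first by rewrite inE rrs orbT.
  by move=> y /predU1P[->|/r_min//]; apply: ltW.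
exists r; first by rewrite prs root_prod_XsubC.
rewrite prs horner_prod normr_prod -srs -[in leLHS](card_ord (size rs)).
rewrite -prodr_const (big_nth 0) big_mkord; apply: ler_prod => i _.
by rewrite normr_ge0 !hornerE r_min // mem_nth.
Qed.

Lemma char_poly_scaleS (F : fieldType) (n : nat) (A : 'M[F]_n.+1) (c a : F)
    (rho : 'I_n -> F) :
  char_poly A = ('X - a%:P) * \prod_(i < n) ('X - (rho i)%:P) ->
  char_poly (c *: A) =
    ('X - (c * a)%:P) * \prod_(i < n) ('X - (c * rho i)%:P).
Proof.
pose rho' i := if unlift ord0 i is Some j then rho j else a.
have prodE (h : F -> F) :
    ('X - (h a)%:P) * \prod_(i < n) ('X - (h (rho i))%:P)
      = \prod_(i < n.+1) ('X - (h (rho' i))%:P).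
  rewrite big_ord_recl {1}/rho' unlift_none; congr (_ * _).
  by apply: eq_bigr => i _; rewrite /rho' liftK.
by rewrite (prodE id) (prodE ( *%R c)); apply: char_poly_scale.
Qed.

(** * Limits along a filter: matrices entrywise, polynomials coefficientwise *)

Section Limits.
Context (K : numClosedFieldType) (T : Type) (F : set_system T) {FF : Filter F}.

Lemma cvg_det (n : nat) (M : T -> 'M[K]_n) (M0 : 'M[K]_n) :
  (forall i j, M t i j @[t --> F] --> M0 i j) ->
  \det (M t) @[t --> F] --> \det M0.
Proof.
move=> MM0; rewrite /determinant.
apply: cvg_big => [|s _]; first exact: add_continuous.
apply: cvgM; first exact: cvg_cst.
apply: cvg_big => [|i _]; [exact: mul_continuous | exact: MM0].
Qed.

Lemma cvg_adj (n : nat) (M : T -> 'M[K]_n) (M0 : 'M[K]_n) :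
  (forall i j, M t i j @[t --> F] --> M0 i j) ->
  forall i j, \adj (M t) i j @[t --> F] --> \adj M0 i j.
Proof.
move=> MM0 i j; under eq_fun do rewrite mxE; rewrite mxE.
apply: cvgM; first exact: cvg_cst.
apply: cvg_det => k l; under eq_fun do rewrite !mxE; rewrite !mxE.
exact: MM0.
Qed.

Lemma cvg_mulmx (m n p : nat) (M : T -> 'M[K]_(m, n)) (N : T -> 'M[K]_(n, p))
    (M0 : 'M[K]_(m, n)) (N0 : 'M[K]_(n, p)) :
  (forall i j, M t i j @[t --> F] --> M0 i j) ->
  (forall i j, N t i j @[t --> F] --> N0 i j) ->
  forall i j, (M t *m N t) i j @[t --> F] --> (M0 *m N0) i j.
Proof.
move=> MM0 NN0 i j; under eq_fun do rewrite mxE; rewrite mxE.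
apply: cvg_big => [|k _]; first exact: add_continuous.
by apply: cvgM; [exact: MM0 | exact: NN0].
Qed.

(** Synthetic division: [q_i = p_(i+1) + r q_(i+1)] expresses the coefficients of the quotient, from
    the top down, continuously in [p] and [r]. *)
Lemma cvg_deflate (n : nat) (p q : T -> {poly K}) (r : T -> K)
    (p0 q0 : {poly K}) (r0 : K) :
  (forall t, p t = ('X - (r t)%:P) * q t) -> p0 = ('X - r0%:P) * q0 ->
  (forall t, size (q t) = n) -> size q0 = n ->
  (forall i, (p t)`_i @[t --> F] --> p0`_i) -> r t @[t --> F] --> r0 ->
  forall i, (q t)`_i @[t --> F] --> q0`_i.
Proof.
move=> pq p0q0 sq sq0 pp0 rr0.
(* Descending induction on the index; coefficients of index at least [n] vanish. *)
suff H k i : (n <= i + k)%N -> (q t)`_i @[t --> F] --> q0`_i.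
  by move=> i; apply: (H n); rewrite leq_addl.
elim: k i => [|k IH] i.
  rewrite addn0 => ni; rewrite nth_default ?sq0 //.
  under eq_fun do rewrite nth_default ?sq //.
  exact: cvg_cst.
rewrite addnS -addSn => /IH cvgS.
have shift (u : {poly K}) (z : K) : u`_i = (('X - z%:P) * u)`_i.+1 + z * u`_i.+1.
  by rewrite mulrBl coefB coefXM coefCM subrK.
rewrite (shift q0 r0) -p0q0; under eq_fun => t do rewrite (shift _ (r t)) -pq.
by apply: cvgD; [exact: pp0 | apply: cvgM].
Qed.

(* The degree drops in the limit: the root [c t / a t] goes to infinity. *)
Lemma cvg_degree_drop (p q : T -> {poly K}) (a c : T -> K) (q0 : {poly K}) :
  (\forall t \near F, (a t *: 'X - (c t)%:P) * q t = p t) ->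
  a t @[t --> F] --> (0 : K) -> c t @[t --> F] --> (1 : K) ->
  (forall i, (p t)`_i @[t --> F] --> (- q0)`_i) ->
  forall i, (q t)`_i @[t --> F] --> q0`_i.
Proof.
move=> pq a0 c1 pq0.
have nc0 : \forall t \near F, c t != 0 by apply: cvgr_neq0 c1 _; rewrite oner_neq0.
have cVp i : (c t)^-1 * - (p t)`_i @[t --> F] --> q0`_i.
  rewrite -[q0`_i]mul1r -[1 in X in _ --> X]invr1 -[q0`_i]opprK -coefN.
  by apply: cvgM; [apply: cvgV (oner_neq0 _) c1 | apply: cvgN].
(* Comparing coefficients gives [a q_(i-1) - c q_i = p_i], a recursion starting at the constant
   coefficient, where 0 stands for [q_(-1)]. Its [a]-term vanishes in the limit once [q_(i-1)]
   converges. *)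
have coefq i : \forall t \near F, (c t)^-1 * - (p t)`_i
    + (c t)^-1 * (a t * (if i is j.+1 then (q t)`_j else 0)) = (q t)`_i.
  near=> t; have ct0 : c t != 0 by near: t.
  apply: (mulfI ct0); rewrite mulrDr !mulVKf //.
  have <- : (a t *: 'X - (c t)%:P) * q t = p t by near: t.
  rewrite mulrBl -scalerAl coefB coefZ coefXM coefCM opprB.
  by case: i => [|i] /=; rewrite subrK.
have cvg_i i (d : T -> K) (d0 : K) : d t @[t --> F] --> d0 ->
    (c t)^-1 * - (p t)`_i + (c t)^-1 * (a t * d t) @[t --> F] --> q0`_i.
  move=> dd0; rewrite -[q0`_i]addr0; apply: cvgD => //.
  rewrite -(mulr0 1^-1) -[0 in X in _ --> X](mul0r d0).
  by apply: cvgM; [apply: cvgV (oner_neq0 _) c1 | apply: cvgM].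
elim=> [|i IH]; apply: cvg_trans (near_eq_cvg (coefq _)) _.
  by apply: cvg_i (cvg_cst 0).
exact: cvg_i IH.
Unshelve. all: by end_near. Qed.

(** Choosing at each [t] the root nearest to [x] makes the power [n.+1] of its distance to [x] at
    most the modulus of [p t] at [x], which tends to 0. *)
Lemma cvg_nearest_root (n : nat) (p : T -> {poly K}) (x : K) :
  (forall t, p t \is monic) -> (forall t, size (p t) = n.+2) ->
  (p t).[x] @[t --> F] --> (0 : K) ->
  exists2 r : T -> K, (forall t, root (p t) (r t)) & r t @[t --> F] --> x.
Proof.
move=> mp sp px0.
have /choice[r rP] t : exists r, root (p t) r /\ `|x - r| ^+ n.+1 <= `|(p t).[x]|.
  by have [r] := nearest_root x (mp t) (sp t); exists r.
exists r => [t|]; first by have [] := rP t.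
apply/cvgrPdist_lt => e e0.
have en0 : 0 < e ^+ n.+1 by apply: exprn_gt0.
have /cvgr0Pnorm_lt/(_ _ en0) := px0; apply: filterS => t pxt.
rewrite -(ltr_pXn2r (n := n.+1)) ?nnegrE ?normr_ge0 ?(ltW e0) //.
by apply: le_lt_trans pxt; have [] := rP t.
Qed.

(** Continuity of roots, with multiplicity: follow the root nearest to [mu ord0], divide it out, and
    recurse on the quotient, whose coefficients converge by [cvg_deflate]. *)
Lemma cvg_roots (n : nat) (p : T -> {poly K}) (mu : 'I_n -> K) :
  (forall t, p t \is monic) -> (forall t, size (p t) = n.+1) ->
  (forall i, (p t)`_i @[t --> F] --> (\prod_(i < n) ('X - (mu i)%:P))`_i) ->
  exists kap : 'I_n -> T -> K,
    (forall t, p t = \prod_(i < n) ('X - (kap i t)%:P)) /\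
    forall i, kap i t @[t --> F] --> mu i.
Proof.
elim: n p mu => [|n IH] p mu mp sp pmu.
  exists (fun=> fun=> 0); split=> [t|[]//].
  rewrite big_ord0; have /size_poly1P[a a0 pa] : size (p t) == 1%N by rewrite sp.
  by have := mp t; rewrite pa monicE lead_coefC => /eqP ->.
rewrite big_ord_recl in pmu.
set q0 := \prod_(i < n) _ in pmu.
have sq0 : size q0 = n.+1.
  by rewrite size_prod_XsubC /index_enum -enumT size_enum_ord.
have [|r rp rmu] := cvg_nearest_root (n := n) (x := mu ord0) mp sp.
  have -> : (0 : K) = (('X - (mu ord0)%:P) * q0).[mu ord0].
    by rewrite hornerM hornerXsubC subrr mul0r.
  (* Evaluation becomes a sum of the same length for all [t] and for the limit, so it converges term
     by term. *)
  rewrite (horner_coef_wide (n := n.+2)); last first.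
    by rewrite (leq_trans (size_polyMleq _ _)) // size_XsubC sq0.
  under eq_fun => t do rewrite (horner_coef_wide (n := n.+2)) ?sp //.
  apply: cvg_big => [|i _]; first exact: add_continuous.
  by apply: cvgM; [exact: pmu | exact: cvg_cst].
pose q t := p t %/ ('X - (r t)%:P).
have pq t : p t = ('X - (r t)%:P) * q t.
  by rewrite mulrC divpK // dvdp_XsubCl.
have mq t : q t \is monic by have := mp t; rewrite pq monicMl ?monicXsubC.
have sq t : size (q t) = n.+1.
  by rewrite size_divp ?polyXsubC_eq0 // size_XsubC sp subn1.
have [kap [qkap kapmu]] := IH q (fun i => mu (lift ord0 i)) mq sq
  (cvg_deflate pq erefl sq sq0 pmu rmu).
exists (fun i => if unlift ord0 i is Some j then kap j else r); split=> [t|i].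
  rewrite big_ord_recl unlift_none pq qkap; congr (_ * _).
  by apply: eq_bigr => i _; rewrite liftK.
by case: unliftP => [j ->|->].
Qed.

(** The matrix [P = nu - w A] tends to the identity and the eigenvector equation reads
    [P v = (y v) x]. Invertibility of [P] forces [y v != 0], and [v / (y v) = P^-1 x] tends to
    [x]. *)
Lemma cvg_eigenvector (n : nat) (x : 'cV[K]_n) (y : 'rV[K]_n) (A : 'M[K]_n)
    (w nu : T -> K) (v : T -> 'cV[K]_n) :
  w t @[t --> F] --> (0 : K) -> nu t @[t --> F] --> (1 : K) ->
  (\forall t \near F, v t != 0 /\ (x *m y + w t *: A) *m v t = nu t *: v t) ->
  (\forall t \near F, (y *m v t) 0 0 != 0) /\
  forall i, ((y *m v t) 0 0)^-1 * v t i 0 @[t --> F] --> x i 0.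
Proof.
move=> w0 nu1 vP; pose P t := (nu t)%:M - w t *: A.
have P1 i j : P t i j @[t --> F] --> (1%:M : 'M[K]_n) i j.
  under eq_fun => t do rewrite !mxE.
  have -> : (1%:M : 'M[K]_n) i j = (i == j)%:R - 0 by rewrite mxE subr0.
  apply: cvgB; last by rewrite -(mul0r (A i j)); apply: cvgM w0 (cvg_cst _).
  by case: (i == j); [exact: nu1 | exact: cvg_cst].
have dP1 : \det (P t) @[t --> F] --> (1 : K) by rewrite -(det1 _ n); apply: cvg_det.
have aPx i : (\adj (P t) *m x) i 0 @[t --> F] --> x i 0.
  have -> : x i 0 = (\adj 1%:M *m x) i 0 by rewrite adj1 mul1mx.
  by apply: cvg_mulmx => [k l|k l]; [exact: cvg_adj | exact: cvg_cst].
have dP0 : \forall t \near F, \det (P t) != 0.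
  by apply: cvgr_neq0 dP1 _; rewrite oner_neq0.
(* [P v = (y v) x], hence Cramer's rule. *)
have cramer : \forall t \near F,
    \det (P t) *: v t = (y *m v t) 0 0 *: (\adj (P t) *m x).
  apply: filterS vP => t [_ Nv]; rewrite -mul_scalar_mx -mul_adj_mx -mulmxA.
  rewrite mulmxBl mul_scalar_mx -Nv mulmxDl addrK -mulmxA.
  by rewrite {1}[y *m _]mx11_scalar mul_mx_scalar -scalemxAr.
have yv0 : \forall t \near F, (y *m v t) 0 0 != 0.
  near=> t; apply/eqP => yv.
  have : \det (P t) *: v t = (y *m v t) 0 0 *: (\adj (P t) *m x) by near: t.
  rewrite yv scale0r => /eqP; rewrite scaler_eq0.
  have /negPf-> : \det (P t) != 0 by near: t.
  have [/negPf-> //] : v t != 0 /\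
    (x *m y + w t *: A) *m v t = nu t *: v t by near: t.
split=> // i.
have E : \forall t \near F,
    (\det (P t))^-1 * (\adj (P t) *m x) i 0 = ((y *m v t) 0 0)^-1 * v t i 0.
  near=> t; have d0 : \det (P t) != 0 by near: t.
  have b0 : (y *m v t) 0 0 != 0 by near: t.
  apply: (mulfI d0); rewrite mulVKf //; apply: (mulfI b0).
  rewrite mulrCA mulVKf //.
  have /matrixP/(_ i 0) : \det (P t) *: v t = (y *m v t) 0 0 *: (\adj (P t) *m x).
    by near: t.
  by rewrite mxE [RHS]mxE.
apply: cvg_trans (near_eq_cvg E) _.
have -> : x i 0 = 1^-1 * x i 0 by rewrite invr1 mul1r.
by apply: cvgM; [apply: cvgV (oner_neq0 _) dP1 | exact: aPx].
Unshelve. all: by end_near. Qed.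

(** Transposition of [cvg_eigenvector], with [x] and [y] exchanging roles. *)
Lemma cvg_left_eigenvector (n : nat) (x : 'cV[K]_n) (y : 'rV[K]_n) (A : 'M[K]_n)
    (w nu : T -> K) (u : T -> 'rV[K]_n) :
  w t @[t --> F] --> (0 : K) -> nu t @[t --> F] --> (1 : K) ->
  (\forall t \near F, u t != 0 /\ u t *m (x *m y + w t *: A) = nu t *: u t) ->
  (\forall t \near F, (u t *m x) 0 0 != 0) /\
  forall i, ((u t *m x) 0 0)^-1 * u t 0 i @[t --> F] --> y 0 i.
Proof.
move=> w0 nu1 uP.
have uTP : \forall t \near F, (u t)^T != 0 /\
    (y^T *m x^T + w t *: A^T) *m (u t)^T = nu t *: (u t)^T.
  apply: filterS uP => t [u0 uN]; rewrite trmx_eq0 u0; split=> //.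
  by rewrite -trmx_mul -linearZ -linearD -trmx_mul uN linearZ.
have [ux uy] := cvg_eigenvector w0 nu1 uTP.
have E t : (x^T *m (u t)^T) 0 0 = (u t *m x) 0 0 by rewrite -trmx_mul mxE.
split=> [|i]; first by apply: filterS ux => t; rewrite E.
have := uy i; rewrite mxE; under eq_fun => t do rewrite E [(u t)^T i 0]mxE.
exact.
Qed.

(* The eigenvalue [nu] of [x y + w A] close to [1]; it is read off from its
   left eigenvector [u], scaled by [u x = 1], as [nu = u (x y + w A) x]. *)
Lemma cvg_dominant_eigenvalue (n : nat) (x : 'cV[K]_n.+1) (y : 'rV[K]_n.+1)
    (A : 'M[K]_n.+1) (w : T -> K) :
  y *m x = 1%:M -> w t @[t --> F] --> (0 : K) ->
  exists2 nu : T -> K,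
    (forall t, root (char_poly (x *m y + w t *: A)) (nu t)) /\
      nu t @[t --> F] --> (1 : K) &
    exists2 g : T -> K, (\forall t \near F, nu t = 1 + w t * g t) &
      g t @[t --> F] --> (y *m A *m x) 0 0.
Proof.
move=> yx w0.
have [t|t||nu nuP nu1] := @cvg_nearest_root n
    (fun t => char_poly (x *m y + w t *: A)) 1.
- exact: char_poly_monic.
- exact: size_char_poly.
- have horner1 (N : 'M[K]_n.+1) : (char_poly N).[1] = \det (1%:M - N).
    rewrite -horner_evalE -det_map_mx; congr (\det _); apply/matrixP => i j.
    by rewrite !mxE /= /horner_eval hornerD hornerN hornerMn hornerX hornerC.
  (* The limit matrix has eigenvalue 1, with left eigenvector [y]. *)
  have -> : (0 : K) = \det (1%:M - x *m y).
    apply/esym/eqP/det0P; exists y.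
      by apply/eqP => y0; have /eqP := yx; rewrite y0 mul0mx eq_sym oner_eq0.
    by rewrite mulmxBr mulmx1 mulmxA yx mul1mx subrr.
  under eq_fun do rewrite horner1; apply: cvg_det => i j.
  have entry t : (1%:M - (x *m y + w t *: A)) i j
      = (1%:M - x *m y) i j - w t * A i j by rewrite !mxE opprD addrA.
  under eq_fun do rewrite entry; set l := (1%:M - x *m y) i j.
  suff : l - w t * A i j @[t --> F] --> l - 0 by rewrite subr0.
  apply: cvgB; first exact: cvg_cst.
  by rewrite -(mul0r (A i j)); apply: cvgM w0 (cvg_cst _).
exists nu => //.
have /choice[u uP] t : exists u : 'rV[K]_n.+1,
    u != 0 /\ u *m (x *m y + w t *: A) = nu t *: u.
  have := nuP t; rewrite -eigenvalue_root_char => /eigenvalueP[u uN u0].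
  by exists u.
have [ux uy] := cvg_left_eigenvector w0 nu1 (nearW _ uP).
(* Multiplying the eigenvector equation by [x] gives [u x + w u A x = nu u x]; moreover [u / (u x)]
   tends to [y]. *)
exists (fun t => ((u t *m x) 0 0)^-1 * (u t *m (A *m x)) 0 0).
  apply: filterS ux => t ux0; have [_ uN] := uP t.
  have /matrixP/(_ 0 0) := congr1 (mulmx^~ x) uN.
  rewrite mulmxDr mulmxDl -!mulmxA yx mulmx1 -!scalemxAl -scalemxAr.
  rewrite mxE [X in _ + X = _]mxE [RHS]mxE => eq_nu.
  apply: (mulIf ux0); rewrite -eq_nu mulrDl mul1r -mulrA mulrAC mulVf //.
  by rewrite mul1r.
rewrite -mulmxA.
have E t : ((u t *m x) 0 0)^-1 * (u t *m (A *m x)) 0 0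
    = ((((u t *m x) 0 0)^-1 *: u t) *m (A *m x)) 0 0.
  by rewrite -scalemxAl [RHS]mxE.
under eq_fun do rewrite E.
apply: cvg_mulmx => [i j|i j]; last exact: cvg_cst.
by rewrite (ord1 i); under eq_fun do rewrite mxE; apply: uy.
Qed.

End Limits.

(** * Matrices [A + w^-1 x y] as [w] tends to 0 *)

(** After multiplication by [w], the factor [w X - nu] carries the root that escapes to infinity.
    [cvg_degree_drop] gives the limit of the cofactor, and [cvg_roots] that of its roots. *)
Lemma cvg_rank1_spectrum (K : numClosedFieldType) (T : Type)
    (F : set_system T) {FF : Filter F} (n : nat) (x : 'cV[K]_n.+1)
    (y : 'rV[K]_n.+1) (A : 'M[K]_n.+1) (chB : {poly K}) (mu : 'I_n -> K)
    (w nu : T -> K) :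
  (forall u, char_poly (A + u *: (x *m y)) = char_poly A - u *: chB) ->
  chB = \prod_(i < n) ('X - (mu i)%:P) ->
  w t @[t --> F] --> (0 : K) -> (\forall t \near F, w t != 0) ->
  (forall t, root (char_poly (x *m y + w t *: A)) (nu t)) ->
  nu t @[t --> F] --> (1 : K) ->
  exists kap : 'I_n -> T -> K,
    (\forall t \near F, char_poly (A + (w t)^-1 *: (x *m y)) =
      ('X - ((w t)^-1 * nu t)%:P) * \prod_(i < n) ('X - (kap i t)%:P)) /\
    forall i, kap i t @[t --> F] --> mu i.
Proof.
move=> update chBE w0 wn0 nuP nu1; pose N t := x *m y + w t *: A.
have /choice[sig sigP] t : exists sig : 'I_n -> K,
    char_poly (N t) = ('X - (nu t)%:P) * \prod_(i < n) ('X - (sig i)%:P).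
  pose q := char_poly (N t) %/ ('X - (nu t)%:P).
  have Nq : char_poly (N t) = ('X - (nu t)%:P) * q.
    by rewrite mulrC divpK ?dvdp_XsubCl ?nuP.
  have mq : q \is monic.
    by have := char_poly_monic (N t); rewrite Nq monicMl ?monicXsubC.
  have [|sig qE] := prod_XsubC_seq (n := n) mq.
    by rewrite size_divp ?polyXsubC_eq0 // size_XsubC size_char_poly subn1.
  by exists sig; rewrite -qE.
(* Where [w t = 0], the convention [0^-1 = 0] makes this [X^n], so [q t] is monic of size [n.+1] for
   every [t], as [cvg_roots] requires. *)
pose q t := \prod_(i < n) ('X - ((w t)^-1 * sig t i)%:P).
have NE t : w t != 0 -> (w t)^-1 *: N t = A + (w t)^-1 *: (x *m y).
  by move=> wt0; rewrite scalerDr scalerA mulVf // scale1r addrC.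
have qE t : w t != 0 -> char_poly (A + (w t)^-1 *: (x *m y)) =
    ('X - ((w t)^-1 * nu t)%:P) * q t.
  by move=> wt0; rewrite -NE //; apply: char_poly_scaleS.
have qchB : forall i, (q t)`_i @[t --> F] --> chB`_i.
  apply: (@cvg_degree_drop _ _ _ _ (fun t => w t *: char_poly A - chB) q w nu)
    => // [|i].
    apply: filterS wn0 => t wt0.
    have -> : w t *: 'X - (nu t)%:P = (w t)%:P * ('X - ((w t)^-1 * nu t)%:P).
      by rewrite mulrBr -polyCM mulVKf // mul_polyC.
    rewrite -mulrA -qE // update mul_polyC scalerBr scalerA mulfV //.
    by rewrite scale1r.
  under eq_fun do rewrite coefB coefZ; rewrite coefN.
  suff : w t * (char_poly A)`_i - chB`_i @[t --> F] --> 0 - chB`_i.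
    by rewrite sub0r.
  apply: cvgB; last exact: cvg_cst.
  move: (char_poly A)`_i => a; rewrite -(mul0r a).
  by apply: cvgM w0 (cvg_cst _).
have [t|t|i|kap [qkap kapmu]] := @cvg_roots K T F FF n q mu.
- by rewrite monic_prod_XsubC.
- by rewrite size_prod_XsubC /index_enum -enumT size_enum_ord.
- by rewrite -chBE.
by exists kap; split=> //; apply: filterS wn0 => t /qE ->; rewrite qkap.
Qed.

(** A left null vector satisfies [v = - w^-1 (v x) y A^-1]. Multiplying by [x] gives
    [(v x) (w + y A^-1 x) = 0], so [v x = 0] and then [v = 0]. *)
Lemma eigenvalue0_rank1_update (F : fieldType) (n : nat) (A : 'M[F]_n)
    (x : 'cV[F]_n) (y : 'rV[F]_n) (w : F) :
  A \in unitmx -> w != 0 -> w + (y *m invmx A *m x) 0 0 != 0 ->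
  ~~ eigenvalue (A + w^-1 *: (x *m y)) 0.
Proof.
move=> Au w0 wb; apply/eigenvalueP => -[v]; rewrite scale0r mulmxDr => vA v0.
have vE : v = - (w^-1 * (v *m x) 0 0) *: (y *m invmx A).
  rewrite scalemxAl; apply: (canRL (mulmxK Au)); move/eqP: vA.
  rewrite addr_eq0 => /eqP ->.
  rewrite -scalemxAr mulmxA {1}[v *m x]mx11_scalar mul_scalar_mx scalerA.
  by rewrite scaleNr.
have vx : (v *m x) 0 0 = 0.
  have /matrixP/(_ 0 0) := congr1 (mulmx^~ x) vE.
  rewrite -scalemxAl [RHS]mxE => vxE; apply/eqP.
  suff : (v *m x) 0 0 * (w + (y *m invmx A *m x) 0 0) == 0.
    by rewrite mulf_eq0 (negPf wb) orbF.
  by rewrite mulrDr {1}vxE mulrC mulNr mulrN !mulrA mulfV // mul1r addNr.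
by move: v0; rewrite vE vx mulr0 oppr0 scale0r eqxx.
Qed.

(** Here [tau] stands for the time step, [tau h] for [z - 1], and [l] for [i omega]. Since
    [M = h^-1 (x y + w A)] with [w = tau h], eigenvectors are shared and [lam1 = nu / h]. The error
    of [lam1] is kept as an identity, to be turned into a rate once that of [h] is known. *)
Lemma rank1_step_asymptotics (K : numClosedFieldType) (T : Type)
    (F : set_system T) {FF : Filter F} (n : nat) (x : 'cV[K]_n.+1)
    (y : 'rV[K]_n.+1) (A : 'M[K]_n.+1) (chB : {poly K}) (mu : 'I_n -> K)
    (tau h : T -> K) (l : K) (M : T -> 'M[K]_n.+1) :
  y *m x = 1%:M -> A \in unitmx -> (y *m invmx A *m x) 0 0 != 0 ->
  (forall u, char_poly (A + u *: (x *m y)) = char_poly A - u *: chB) ->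
  chB = \prod_(i < n) ('X - (mu i)%:P) ->
  l != 0 -> h t @[t --> F] --> l ->
  tau t @[t --> F] --> (0 : K) -> (\forall t \near F, tau t != 0) ->
  (\forall t \near F, M t = tau t *: (A + (tau t * h t)^-1 *: (x *m y))) ->
  exists (lam1 : T -> K) (kap : 'I_n -> T -> K),
  [/\ \forall t \near F, char_poly (M t) =
        ('X - (lam1 t)%:P) * \prod_(i < n) ('X - (tau t * kap i t)%:P),
      (forall i, kap i t @[t --> F] --> mu i) /\ lam1 t @[t --> F] --> l^-1,
      exists d g : T -> K,
        [/\ \forall t \near F, lam1 t - l^-1 = - (h t - l) * d t + tau t * g t,
            d t @[t --> F] --> l^-1 * l^-1 &
            g t @[t --> F] --> (y *m A *m x) 0 0],
      (forall v : T -> 'cV[K]_n.+1,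
         (\forall t \near F, v t != 0 /\ M t *m v t = lam1 t *: v t) ->
         (\forall t \near F, (y *m v t) 0 0 != 0) /\
         forall i, ((y *m v t) 0 0)^-1 * v t i 0 @[t --> F] --> x i 0) /\
      (forall u : T -> 'rV[K]_n.+1,
         (\forall t \near F, u t != 0 /\ u t *m M t = lam1 t *: u t) ->
         (\forall t \near F, (u t *m x) 0 0 != 0) /\
         forall i, ((u t *m x) 0 0)^-1 * u t 0 i @[t --> F] --> y 0 i) &
      \forall t \near F, ~~ eigenvalue (M t) 0].
Proof.
move=> yx Au beta0 update chBE l0 h_l tau0 taun0 ME.
have h0 : \forall t \near F, h t != 0 by apply: cvgr_neq0 h_l l0.
pose w t := tau t * h t.
have w0 : w t @[t --> F] --> (0 : K) by rewrite -(mul0r l); apply: cvgM.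
have wn0 : \forall t \near F, w t != 0.
  by near=> t; rewrite mulf_neq0 //; near: t.
have MN : \forall t \near F, M t = (h t)^-1 *: (x *m y + w t *: A).
  near=> t; have wt0 : w t != 0 by near: t.
  have ht0 : h t != 0 by near: t.
  have -> : M t = tau t *: (A + (w t)^-1 *: (x *m y)) by near: t.
  rewrite !scalerDr !scalerA addrC; congr (_ *: _ + _ *: _).
    by rewrite invfM mulVKf //; near: t.
  by rewrite mulrCA mulVf // mulr1.
have [nu [nuP nu1] [g nuE g0]] := cvg_dominant_eigenvalue A yx w0.
have [kap [kapP kapmu]] := cvg_rank1_spectrum update chBE w0 wn0 nuP nu1.
have hV : (h t)^-1 @[t --> F] --> l^-1 by apply: cvgV.
exists (fun t => (h t)^-1 * nu t), kap; split.
- near=> t.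
  have -> : (h t)^-1 * nu t = tau t * ((w t)^-1 * nu t).
    by rewrite invfM mulrA mulVKf //; near: t.
  have -> : M t = tau t *: (A + (w t)^-1 *: (x *m y)) by near: t.
  by apply: char_poly_scaleS; near: t.
- split=> //; rewrite -[l^-1]mulr1; exact: cvgM.
(* With [nu = 1 + w g] and [w / h = tau], the error is [1 / h - 1 / l + tau g]. *)
- exists (fun t => (h t)^-1 * l^-1), g; split=> //; last first.
    by apply: cvgM (cvg_cst _).
  near=> t; have ht0 : h t != 0 by near: t.
  have -> : nu t = 1 + w t * g t by near: t.
  rewrite mulNr mulrBl mulVKf // mulrCA mulfV // mulr1 opprB.
  by rewrite mulrDr mulr1 -mulrA mulrCA mulKf // addrAC.
- split=> [v vP|u uP].
    apply: cvg_eigenvector w0 nu1 _; near=> t.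
    have [vt0] : v t != 0 /\ M t *m v t = ((h t)^-1 * nu t) *: v t by near: t.
    have -> : M t = (h t)^-1 *: (x *m y + w t *: A) by near: t.
    rewrite -scalemxAl -scalerA => /scalerI Nv; split=> //; apply: Nv.
    by rewrite invr_eq0; near: t.
  apply: cvg_left_eigenvector w0 nu1 _; near=> t.
  have [ut0] : u t != 0 /\ u t *m M t = ((h t)^-1 * nu t) *: u t by near: t.
  have -> : M t = (h t)^-1 *: (x *m y + w t *: A) by near: t.
  rewrite -scalemxAr -scalerA => /scalerI uN; split=> //; apply: uN.
  by rewrite invr_eq0; near: t.
have wb : \forall t \near F, w t + (y *m invmx A *m x) 0 0 != 0.
  apply: cvgr_neq0 beta0; rewrite -[X in _ --> X]add0r.
  by apply: cvgD w0 (cvg_cst _).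
near=> t.
have -> : M t = tau t *: (A + (w t)^-1 *: (x *m y)) by near: t.
have : ~~ eigenvalue (A + (w t)^-1 *: (x *m y)) 0.
  by apply: eigenvalue0_rank1_update => //; near: t.
apply: contra => /eigenvalueP[v]; rewrite scale0r -scalemxAr => /eqP.
have /negPf tt0 : tau t != 0 by near: t.
rewrite scaler_eq0 tt0 => /eqP vM v0.
by apply/eigenvalueP; exists v; rewrite ?scale0r.
Unshelve. all: by end_near. Qed.

(** * Bounds for the exponential, and the modulus on [R[i]] *)

(** Repeated use of the mean value theorem, each time bounding the derivative by the preceding
    estimate; the constants are crude, only the quadratic order matters. *)
Lemma ge0_cos_sin_bound (R : realType) (x : R) : 0 <= x ->
  `|cos x - 1| <= x ^+ 2 /\ `|sin x - x| <= x ^+ 2.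
Proof.
move=> x0.
have sin_le (y : R) : 0 <= y -> `|sin y| <= y.
  move=> y0; have [|c _] := @MVT_segment R sin cos 0 y y0.
    by apply: continuous_subspaceT => z; apply: continuous_sin.
  rewrite sin0 !subr0 => ->; rewrite normrM (ger0_norm y0) ler_piMl //.
  by rewrite ler_norml cos_geN1 cos_le1.
have cos_le (y : R) : 0 <= y -> exists2 c, 0 <= c <= y & `|cos y - 1| = `|sin c| * y.
  move=> y0; have [|c] := @MVT_segment R cos (fun z => - sin z) 0 y y0.
    by apply: continuous_subspaceT => z; apply: continuous_cos.
  rewrite in_itv /= cos0 subr0 => cy ->; exists c => //.
  by rewrite normrM normrN (ger0_norm y0).
split.
  have [c /andP[c0 cx] ->] := cos_le x x0.
  by rewrite expr2 ler_wpM2r // (le_trans (sin_le c c0)).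
have [|c] := @MVT_segment R (fun z => sin z - z) (fun z => cos z - 1) 0 x x0.
  apply: continuous_subspaceT => z; apply: continuousB => //.
  exact: continuous_sin.
rewrite in_itv /= sin0 !subr0 => /andP[c0 cx] ->.
rewrite normrM (ger0_norm x0) expr2 ler_wpM2r //.
have [d /andP[d0 dc] ->] := cos_le c c0; apply: le_trans cx.
by rewrite ler_piMl // ler_norml sin_geN1 sin_le1.
Qed.

Lemma cos_sin_bound (R : realType) (x : R) :
  `|cos x - 1| <= x ^+ 2 /\ `|sin x - x| <= x ^+ 2.
Proof.
have [x0|/ltW x0] := leP 0 x; first exact: ge0_cos_sin_bound.
have [|cx sx] := @ge0_cos_sin_bound R (- x); first by rewrite oppr_ge0.
by move: cx sx; rewrite cosN sinN sqrrN -opprD normrN.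
Qed.

Lemma normr_normc (R : rcfType) (z : R[i]) : `|z| = (normc z)%:C.
Proof. by case: z => a b; rewrite normc_def. Qed.

Lemma normc_real (R : rcfType) (x : R) : normc x%:C = `|x|.
Proof. by rewrite /normc /= expr0n addr0 sqrtr_sqr. Qed.

Lemma normc_ge0 (R : rcfType) (z : R[i]) : 0 <= normc z.
Proof. by case: z => a b; apply: sqrtr_ge0. Qed.

Lemma ler_dist_normc (R : rcfType) (y z : R[i]) :
  `|normc y - normc z| <= normc (y - z).
Proof.
by rewrite -lecR -normr_normc -normc_real -normr_normc rmorphB /= -!normr_normc
  ler_dist_dist.
Qed.

Lemma normc_le_ReIm (R : rcfType) (a b : R) : normc (a +i* b) <= `|a| + `|b|.
Proof.
have -> : a +i* b = a%:C + (0 +i* b) by simpc.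
apply: le_trans (le_normcD _ _) _; rewrite normc_real lerD2l.
by rewrite /normc expr0n add0r sqrtr_sqr.
Qed.

(* [R[i]] seen as an abstract field, which makes its norm topology available. *)
Definition complexK (R : realType) : numClosedFieldType := R[i].

Section ComplexLimits.
Context (R : realType) (T : Type) (F : set_system T) {FF : Filter F}.

(** Bridge from the topology of the complex field, whose norm takes values in [R[i]], to the
    real-valued moduli of the theorem. *)
Lemma cvg_normcP (f : T -> complexK R) (l : complexK R) :
  (f t @[t --> F] --> l) <-> (normc (f t - l) @[t --> F] --> (0 : R)).
Proof.
split=> [/cvgr_dist_lt fl|fl].
  apply/cvgr0Pnorm_lt => e e0.
  have /fl : 0 < e%:C :> R[i] by rewrite ltcR.
  apply: filterS => t; rewrite distrC normr_normc ltcR.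
  by rewrite ger0_norm ?normc_ge0.
(* A positive element of [R[i]] has zero imaginary part, so the tolerance is real. *)
apply/cvgrPdist_lt => -[e1 e2]; rewrite ltcE /= => /andP[/eqP-> e0].
move/cvgr0Pnorm_lt/(_ _ e0): fl; apply: filterS => t.
by rewrite distrC normr_normc ltcR ger0_norm ?normc_ge0.
Qed.

Lemma cvg_normc (f : T -> complexK R) (l : complexK R) :
  f t @[t --> F] --> l -> normc (f t) @[t --> F] --> normc l.
Proof.
move=> /cvg_normcP fl; apply/cvgrPdist_lt => e e0.
move/cvgr0Pnorm_lt/(_ _ e0): fl; apply: filterS => t.
rewrite ger0_norm ?normc_ge0 // distrC; apply: le_lt_trans.
exact: ler_dist_normc.
Qed.

Lemma cvg_normc_bounded (f : T -> complexK R) (l : complexK R) :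
  f t @[t --> F] --> l -> \forall t \near F, normc (f t) <= normc l + 1.
Proof.
by move=> /cvg_normc fl; apply: cvgr_le fl _ _; rewrite ltrDl.
Qed.

End ComplexLimits.

Lemma cvg_right0 (R : realType) :
  (t%:C : complexK R) @[t --> right0] --> (0 : complexK R).
Proof.
apply/cvg_normcP; under eq_fun do rewrite subr0 normc_real.
by apply/norm_cvg0P; apply: cvg_at_right_filter; apply: cvg_id.
Qed.

Lemma cexpi_sub1_bound (R : realType) (x : R) :
  normc (cexpi x - 1 - (0 +i* x)) <= x ^+ 2 *+ 2.
Proof.
have -> : cexpi x - 1 - (0 +i* x) = (cos x - 1) +i* (sin x - x).
  by rewrite /cexpi; simpc.
have [cb sb] := cos_sin_bound x.
by rewrite mulr2n; apply: le_trans (normc_le_ReIm _ _) (lerD cb sb).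
Qed.

(** * Specialization to the Runge-Kutta matrix *)

(** Consistency forces [b] to be nonzero, hence of rank 1. *)
Lemma rank_kermx_consistent (R : realType) (n : nat) (b : 'cV[R]_n.+1) :
  consistent b -> \rank (kermx b) = n.
Proof.
move=> be; rewrite mxrank_ker; suff -> : \rank b = 1 by rewrite subn1.
apply/eqP; rewrite eqn_leq rank_leq_col lt0n mxrank_eq0.
by apply/eqP => b0; move/eqP: be; rewrite b0 trmx0 mul0mx eq_sym oner_eq0.
Qed.

(** Instance of [char_poly_rank1_update] in which [V] is the basis of [b^perp] underlying [restrB];
    its hypotheses are checked over [R] and transported to [R[i]]. *)
Lemma char_poly_restrB (R : realType) (n : nat) (A : 'M[R]_n.+1)
    (b : 'cV[R]_n.+1) (u : R[i]) : consistent b ->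
  char_poly (mxC A + u *: (mxC (ones R n.+1) *m mxC b^T))
  = char_poly (mxC A) - u *: char_poly (mxC (restrB A b)).
Proof.
move=> be; set V := row_base (kermx b).
have VB : V *m (projQ b *m A)^T = restrB A b *m V.
  by rewrite /restrB /conjmx mulmxKpV // stablemx_row_base stable_bperp.
have fV : row_free V by apply: row_base_free.
have Vb : V *m b = 0 by apply/sub_kermxP; rewrite eq_row_base.
have rn : (\rank (kermx b)).+1 = n.+1 by rewrite rank_kermx_consistent.
rewrite -map_trmx; clearbody V.
apply: (char_poly_rank1_update (V := mxC V)) => //.
- by rewrite map_trmx -map_mxM be map_mx1.
- by rewrite row_free_map.
- by rewrite -map_mxM Vb map_mx0.
by rewrite -map_mxM -VB map_mxM -map_trmx map_mxM map_mxB map_mx1 map_mxM map_trmx.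
Qed.

(** The difference quotient of the exponential at 0. Its linear rate, with [C = 2 omega^2] from
    [cexpi_sub1_bound], is what yields an [O(dt)] error for [lam1]. *)
Lemma cexpi_quotient (R : realType) (omega : R) :
  exists h : R -> complexK R, [/\
    \forall t \near right0, cexpi (omega * t) - 1 = t%:C * h t,
    h t @[t --> right0] --> (0 +i* omega : complexK R) &
    exists2 C : R, 0 <= C &
      \forall t \near right0, normc (h t - (0 +i* omega)) <= C * t].
Proof.
exists (fun t => (cexpi (omega * t) - 1) / t%:C).
have hC : \forall t \near right0, normc ((cexpi (omega * t) - 1) / t%:C
    - (0 +i* omega)) <= (omega ^+ 2 *+ 2) * t.
  near=> t; have t0 : 0 < t by near: t; apply: nbhs_right_gt.
  have tC0 : t%:C != 0 :> R[i] by rewrite fmorph_eq0 gt_eqF.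
  have -> : (cexpi (omega * t) - 1) / t%:C - (0 +i* omega)
      = (cexpi (omega * t) - 1 - (0 +i* (omega * t))) / t%:C.
    rewrite [RHS]mulrBl; congr (_ - _); apply: (mulIf tC0).
    by rewrite divfK //; simpc; rewrite mulrC.
  rewrite normcM normcV normc_real (ger0_norm (ltW t0)) ler_pdivrMr //.
  apply: le_trans (cexpi_sub1_bound _) _.
  by rewrite exprMn -mulrnAl [t ^+ 2]expr2 mulrA.
split; last by exists (omega ^+ 2 *+ 2); rewrite ?mulrn_wge0 ?sqr_ge0.
- near=> t; have t0 : 0 < t by near: t; apply: nbhs_right_gt.
  by rewrite [RHS]mulrC divfK // fmorph_eq0 gt_eqF.
- apply/cvg_normcP; apply: (@squeeze_cvgr _ _ _ _ (fun=> 0)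
    (fun t => (omega ^+ 2 *+ 2) * t)); last 2 first.
  + exact: cvg_cst.
  + suff : (omega ^+ 2 *+ 2) * t @[t --> right0] --> (omega ^+ 2 *+ 2) * 0.
      by rewrite mulr0.
    apply: cvgM; first exact: cvg_cst.
    by apply: cvg_at_right_filter; apply: cvg_id.
  apply: filterS hC => t; rewrite normc_ge0.
Unshelve. all: by end_near. Qed.

Theorem theorem2p4 (R : realType) (s : nat)
    (A : 'M[R]_s) (b c : 'cV[R]_s)
    (hc : c = A *m ones R s)
    (hconsistent : consistent b)
    (hspec : spectrum_nonneg_Re A)
    (hdiag : uniformly_diagonalizable A b)
    (hAinv : A \in unitmx)
    (hbAe : b^T *m invmx A *m ones R s != 0)
    (omega : R) (homega : omega != 0) :
  exists (lam1 : R -> R[i]) (lam : 'I_s.-1 -> R -> R[i]) (mu : 'I_s.-1 -> R[i]),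
  (\forall dt \near right0, cexpi (omega * dt) != 1 /\
     char_poly (stepM A b omega dt) =
       ('X - (lam1 dt)%:P) * \prod_(i < s.-1) ('X - (lam i dt)%:P)) /\
  [/\ (fun dt : R => normc (lam1 dt - (0 +i* omega)^-1))
        =O_right0 (fun dt : R => dt),
      (fun dt : R => normc (lam1 dt)) =O_right0 (fun=> 1 : R),
      (exists2 m : R, 0 < m & \forall dt \near right0, m <= normc (lam1 dt)),
      (forall v : R -> 'cV[R[i]]_s,
         (\forall dt \near right0, v dt != 0 /\
            stepM A b omega dt *m v dt = lam1 dt *: v dt) ->
         tends_upto_scaling v (ones R s)) &
      (forall u : R -> 'rV[R[i]]_s,
         (\forall dt \near right0, u dt != 0 /\
            u dt *m stepM A b omega dt = lam1 dt *: u dt) ->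
         tends_upto_scaling u b^T)] /\
  [/\ (forall i, \forall dt \near right0, lam i dt != 0),
      (forall i, (fun dt : R => normc (lam i dt))
         =O_right0 (fun dt : R => dt)),
      (forall i, (fun dt : R => normc (lam i dt - dt%:C * mu i))
         =o_right0 (fun dt : R => dt)) &
      char_poly (mxC (restrB A b)) = \prod_(i < s.-1) ('X - (mu i)%:P)] /\
  (\forall dt \near right0, ~~ eigenvalue (stepM A b omega dt) 0).
Proof.
case: s A b c hc hconsistent hspec hdiag hAinv hbAe
  => [|n] A b c _ be _ _ Au bAe /=.
  (* A scheme without stages is not consistent: the empty sum is not 1. *)
  by move/eqP: be; rewrite [b]flatmx0 trmx0 mul0mx eq_sym oner_eq0.
pose iw : complexK R := 0 +i* omega.
have iw0 : iw != 0.
  by apply/eqP => /(congr1 (@complex.Im R)) /= om0; rewrite om0 eqxx in homega.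
have [h [wE h_iw [C C0 hC]]] := cexpi_quotient omega.
have t_gt0 : \forall t \near right0, (0 : R) < t := nbhs_right_gt _.
have tC0 : \forall t \near right0, t%:C != 0 :> complexK R.
  by apply: filterS t_gt0 => t t0; rewrite fmorph_eq0 gt_eqF.
pose x := mxC (ones R n.+1) : 'cV[complexK R]_n.+1.
pose y := mxC b^T : 'rV[complexK R]_n.+1.
pose AC := mxC A : 'M[complexK R]_n.+1.
have yx : y *m x = 1%:M by rewrite -map_mxM be map_mx1.
have ME : \forall t \near right0, stepM A b omega t
    = (t%:C : complexK R) *: (AC + (t%:C * h t)^-1 *: (x *m y)).
  apply: filterS wE => t wE.
  by rewrite /stepM -wE scalerDr scalerA -map_mxM.
have [|mu muE] := @prod_XsubC_seq (complexK R) n (char_poly (mxC (restrB A b)))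
  (char_poly_monic _).
  by rewrite size_char_poly rank_kermx_consistent.
have AuC : AC \in unitmx by rewrite map_unitmx.
have beta0 : (y *m invmx AC *m x) 0 0 != 0.
  rewrite -map_invmx -!map_mxM mxE fmorph_eq0; apply: contra bAe => /eqP bAe.
  by rewrite [_ *m _]mx11_scalar bAe raddf0.
have [lam1 [kap [chM [kapmu lam1_iw] [d [g [lam1E d0 g0]]] [rightP leftP] M0]]] :=
  rank1_step_asymptotics yx AuC beta0 (fun u => char_poly_restrB A u be) muE
    iw0 h_iw (@cvg_right0 R) tC0 ME.
exists lam1, (fun i t => t%:C * kap i t), mu.
split; last split; last split; last exact: M0.
- near=> t; split; last by near: t.
  (* [h] is close to [i omega], so [z - 1 = t h] is nonzero. *)
  have ht0 : h t != 0 by near: t; apply: cvgr_neq0 h_iw iw0.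
  rewrite -subr_eq0; have -> : cexpi (omega * t) - 1 = t%:C * h t by near: t.
  by rewrite mulf_neq0 //; near: t.
- split.
  (* In [lam1 - iw^-1 = - (h - iw) d + t g] the first term is at most [C t B] and the second at most
     [t G]; the added 1 leaves room above the limits of the moduli of [d] and [g]. *)
  + apply/eqO_exP; set B := normc (iw^-1 * iw^-1) + 1.
    set G := normc ((y *m AC *m x) 0 0) + 1.
    exists (C * B + G).
      by rewrite ltr_wpDl ?mulr_ge0 ?ltr_wpDl ?addr_ge0 ?normc_ge0 ?ltr01.
    have dB : \forall t \near right0, normc (d t) <= B := cvg_normc_bounded d0.
    have gG : \forall t \near right0, normc (g t) <= G := cvg_normc_bounded g0.
    near=> t; have t0 : 0 < t by near: t.
    rewrite !ger0_norm ?normc_ge0 ?(ltW t0) //.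
    have -> : lam1 t - iw^-1 = - (h t - iw) * d t + t%:C * g t by near: t.
    apply: le_trans (le_normcD _ _) _; rewrite mulrDl; apply: lerD.
      rewrite normcM normcN mulrAC; apply: ler_pM; rewrite ?normc_ge0 //.
        by near: t; exact: hC.
      by near: t; exact: dB.
    rewrite normcM normc_real (ger0_norm (ltW t0)) mulrC ler_wpM2r ?(ltW t0) //.
    by near: t; exact: gG.
  + apply/eqO_exP; exists (normc iw^-1 + 1); first by rewrite ltr_wpDl ?normc_ge0.
    apply: filterS (cvg_normc_bounded lam1_iw) => t.
    by rewrite normr1 mulr1 ger0_norm ?normc_ge0.
  + have nV0 : 0 < normc iw^-1.
      rewrite lt0r normc_ge0 andbT; apply: contra iw0 => /eqP/eq0_normc/eqP.
      by rewrite invr_eq0.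
    exists (normc iw^-1 / 2); first by rewrite divr_gt0.
    apply: cvgr_ge (cvg_normc lam1_iw) _ _.
    by rewrite ltr_pdivrMr // mulr2n mulrDr mulr1 ltrDl.
  + move=> v /rightP[yv vx].
    (* Scaled this way, the eigenvector has product 1 with [b^T], as its limit [e] does. *)
    exists (fun t => ((y *m v t) 0 0)^-1); split.
      by apply: filterS yv => t; rewrite invr_eq0.
    move=> i j; rewrite (ord1 j); have /cvg_normcP := vx i.
    by rewrite mxE.
  + move=> u /leftP[ux uy].
    exists (fun t => ((u t *m x) 0 0)^-1); split.
      by apply: filterS ux => t; rewrite invr_eq0.
    move=> i j; rewrite (ord1 i); have /cvg_normcP := uy j.
    by rewrite [y _ _]mxE.
- split=> [i|i|i|].
  (* A vanishing [lam i] would be a root of the characteristic polynomial, that is, a zero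
     eigenvalue. *)
  + near=> t; have : ~~ eigenvalue (stepM A b omega t) 0 by near: t.
    apply: contra => lam0; rewrite eigenvalue_root_char.
    have -> : char_poly (stepM A b omega t) = ('X - (lam1 t)%:P)
      * \prod_(i < n) ('X - (t%:C * kap i t)%:P) by near: t.
    by rewrite rootM (bigD1 i) //= rootM !root_XsubC (eqP lam0) eqxx orbT.
  + apply/eqO_exP; exists (normc (mu i) + 1); first by rewrite ltr_wpDl ?normc_ge0.
    have kB : \forall t \near right0, normc (kap i t) <= normc (mu i) + 1 :=
      cvg_normc_bounded (kapmu i).
    near=> t; have t0 : 0 < t by near: t.
    rewrite !ger0_norm ?normc_ge0 ?(ltW t0) // normcM normc_real.
    rewrite (ger0_norm (ltW t0)) mulrC ler_wpM2r ?(ltW t0) //.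
    by near: t; exact: kB.
  (* The difference is [dt (kap i - mu i)], whose second factor tends to 0. *)
  + apply/eqoP => e e0; have /cvg_normcP/cvgr0Pnorm_le/(_ e e0) kmu := kapmu i.
    near=> t; have t0 : 0 < t by near: t.
    rewrite -mulrBr normcM normc_real normrM normr_id mulrC.
    by rewrite ler_wpM2r //; near: t.
  + exact: muE.
Unshelve. all: by end_near. Qed.
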